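(* Let $G$ be a graph with no isolated vertices, and let $\alpha\in[0,1]$. Then $B_\alpha(G)$ is positive semidefinite if and only if $\alpha\in[0,\beta_o(G)]$.
   Context: All graphs are simple and undirected, with a finite vertex set. $A(G)$ is the adjacency matrix, $D(G)$ the diagonal matrix of vertex degrees, and $L(G)=D(G)-A(G)$ the Laplacian matrix of $G$. For $\alpha\in[0,1]$, $B_\alpha(G):=\alpha A(G)+(1-\alpha)L(G)$. The eigenvalues of a real symmetric $n\times n$ matrix $S$ are ordered $\lambda_1(S)\ge\lambda_2(S)\ge\cdots\ge\lambda_n(S)$ (with multiplicity). For a graph $G$ on $n$ vertices with at least one edge, $\beta_o(G):=\max\{\beta\in(0,1):\lambda_n(B_\beta(G))=0\}$. *)

(* Defs.v *)
From HB Require Import structures.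
From mathcomp Require Import all_boot all_order all_algebra.
From mathcomp Require Import boolp classical_sets reals.

Set Implicit Arguments.
Unset Strict Implicit.
Unset Printing Implicit Defensive.

Import Order.TTheory GRing.Theory Num.Theory.

Local Open Scope ring_scope.

Record sgraph (V : finType) := SGraph {
  adj : rel V;
  adj_sym : symmetric adj;
  adj_irrefl : irreflexive adj
}.

Definition degree (V : finType) (G : sgraph V) (v : V) : nat :=
  #|[set w | adj G v w]|.

Definition isolated (V : finType) (G : sgraph V) (v : V) : bool :=
  [forall w, ~~ adj G v w].

(* Rows and columns are indexed by 'I_#|V|, through the enumeration of V. *)
Definition adjacency (R : realType) (V : finType) (G : sgraph V) :
    'M[R]_#|V| :=
  \matrix_(i, j) (adj G (enum_val i) (enum_val j))%:R.

Definition degree_mx (R : realType) (V : finType) (G : sgraph V) :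
    'M[R]_#|V| :=
  diag_mx (\row_i (degree G (enum_val i))%:R).

Definition laplacian (R : realType) (V : finType) (G : sgraph V) :
    'M[R]_#|V| :=
  degree_mx R G - adjacency R G.

Definition Bmx (R : realType) (V : finType) (G : sgraph V) (a : R) :
    'M[R]_#|V| :=
  a *: adjacency R G + (1 - a) *: laplacian R G.

Definition psdmx (R : realType) (n : nat) (S : 'M[R]_n) : Prop :=
  S^T = S /\ forall x : 'cV[R]_n, 0 <= (x^T *m S *m x) 0 0.

(* The roots of the characteristic polynomial with multiplicity, in
   nonincreasing order. Such a sequence is unique, and it exists when S is
   symmetric; otherwise, if there is none, the value is the empty sequence. *)
Definition eigenvalues (R : realType) (n : nat) (S : 'M[R]_n) : seq R :=
  xget [::] [set s : seq R |
    sorted >=%R s /\ char_poly S = \prod_(x <- s) ('X - x%:P)]%classic.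

(* 1-based: lambda S 1 is the largest eigenvalue of S : 'M_n, and lambda S n
   the smallest. *)
Definition lambda (R : realType) (n : nat) (S : 'M[R]_n) (k : nat) : R :=
  nth 0 (eigenvalues S) k.-1.

Definition is_max (R : realType) (A : set R) (m : R) : Prop :=
  A m /\ forall x, A x -> x <= m.

(* The default value 0 of xget is used only if the maximum does not exist. *)
Definition beta_o (R : realType) (V : finType) (G : sgraph V) : R :=
  xget 0 (is_max
    [set b : R | 0 < b < 1 /\ lambda (Bmx G b) #|V| = 0]%classic).

(* Main.v *)
Require Import Defs.
From mathcomp Require Import all_boot all_order all_algebra.
From mathcomp Require Import boolp classical_sets reals.
From mathcomp Require Import spectral sesquilinear complex ring lra.

(** Write [A], [D], [L] for the adjacency, degree and Laplacian matrices. Then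
    [B_a = (1 - a) D + (2 a - 1) A], and without isolated vertices [D] is
    positive definite. So the pencil [A - mu D] has a least generalized
    eigenvalue [mu]: there is [x0 != 0] with [A x0 = mu D x0], while
    [mu * x^T D x <= x^T A x] for all [x] ([pencil_min_eigenvector]). It is the
    least eigenvalue of the normalized adjacency matrix [D^-1/2 A D^-1/2]. It is
    negative, as one sees on [x = e_u - e_v] for an edge [uv], where
    [x^T A x = -2].

    Now [B_a x0 = (1 - mu - a (1 - 2 mu)) D x0], and the scalar factor vanishes
    exactly at [b = (1 - mu) / (1 - 2 mu)], which lies in [(1/2, 1)]. If [a > b]
    the factor is negative and [x0] shows that [B_a] is not positive
    semidefinite. At [a = b] we have
    [x^T B_b x = (2 b - 1) (x^T A x - mu * x^T D x) >= 0]. At [a = 0] we have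
    [B_0 = L], which is positive semidefinite ([quad_laplacian_ge0]). As [B_a] is
    affine in [a], it is positive semidefinite on all of [[0, b]].

    It remains to identify [b] with [beta_o]. A symmetric matrix whose least
    eigenvalue is [0] is positive semidefinite ([psdmx_lambda_min_eq0]), so no
    [c > b] in [(0, 1)] qualifies; and a singular positive semidefinite matrix has
    least eigenvalue [0] ([lambda_min_eq0]), so [b] itself qualifies. Both facts,
    and the existence of [mu], rest on two properties of the last entry of the
    ordered list of roots of the characteristic polynomial: it bounds the
    Rayleigh quotient from below ([lambda_min_quad]), and it has a real
    eigenvector ([lambda_min_eigenvector]). *)

Set Implicit Arguments.
Unset Strict Implicit.
Unset Printing Implicit Defensive.

Import Order.TTheory GRing.Theory Num.Theory.

Local Open Scope ring_scope.
Local Open Scope sesquilinear_scope.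

(** * Quadratic forms *)

Definition quad (R : comPzRingType) n (S : 'M[R]_n) (x : 'cV[R]_n) : R :=
  (x^T *m S *m x) 0 0.

Section QuadraticForms.
Variables (R : comPzRingType) (n : nat).
Implicit Types (S T : 'M[R]_n) (x : 'cV[R]_n).

Lemma quadD S T x : quad (S + T) x = quad S x + quad T x.
Proof. by rewrite /quad mulmxDr mulmxDl mxE. Qed.

Lemma quadZ a S x : quad (a *: S) x = a * quad S x.
Proof. by rewrite /quad -scalemxAr -scalemxAl mxE. Qed.

Lemma quadE S x : quad S x = \sum_i \sum_j S i j * (x i 0 * x j 0).
Proof.
rewrite /quad mxE exchange_big; apply: eq_bigr => j _ /=.
rewrite mxE mulr_suml; apply: eq_bigr => i _; rewrite mxE; ring.
Qed.

Lemma quad_diag d x : quad (diag_mx d) x = \sum_i d 0 i * x i 0 ^+ 2.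
Proof.
rewrite quadE; apply: eq_bigr => i _; rewrite (bigD1 i)//= big1 ?addr0.
  by rewrite mxE eqxx expr2.
by move=> j ji; rewrite mxE eq_sym (negPf ji) mul0r.
Qed.

Lemma quad_congr S P x : quad (P^T *m S *m P) x = quad S (P *m x).
Proof. by rewrite /quad trmx_mul !mulmxA. Qed.

End QuadraticForms.

Lemma quad_diag_gt0 (R : realDomainType) n (d : 'rV[R]_n) (x : 'cV[R]_n) :
  (forall i, 0 < d 0 i) -> x != 0 -> 0 < quad (diag_mx d) x.
Proof.
move=> d_gt0 /cV0Pn[i xi0]; rewrite quad_diag (bigD1 i)//= ltr_pwDl//.
  by rewrite mulr_gt0// exprn_even_gt0.
by apply: sumr_ge0 => j _; rewrite mulr_ge0 ?sqr_ge0// ltW.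
Qed.

Lemma quad1_gt0 (R : realDomainType) n (x : 'cV[R]_n) :
  x != 0 -> 0 < quad 1%:M x.
Proof.
by rewrite -diag_const_mx; apply: quad_diag_gt0 => i; rewrite mxE.
Qed.

(** * The real spectral theorem *)

Lemma char_poly_similar (R : comUnitRingType) n (P A B : 'M[R]_n) :
  P \in unitmx -> A = invmx P *m B *m P -> char_poly A = char_poly B.
Proof.
move=> Pu ->; rewrite /char_poly /char_poly_mx.
have -> : 'X%:M - map_mx polyC (invmx P *m B *m P) =
   map_mx polyC (invmx P) *m ('X%:M - map_mx polyC B) *m map_mx polyC P.
  rewrite mulmxBr mulmxBl !map_mxM -!mulmxA; congr (_ - _).
  rewrite mul_scalar_mx -scalemxAr -map_mxM mulVmx// map_mx1.
  by rewrite scalemx1.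
rewrite !det_mulmx mulrC mulrA -det_mulmx -map_mxM mulmxV// map_mx1 det1.
by rewrite mul1r.
Qed.

(** The unitary diagonalization of Hermitian matrices is applied to [S] over
    [R[i]], and its two consequences are brought back to [R]: the diagonal is
    real, and both [x^T S x] and [x^T x] become sums over the coordinates [y_i]
    of [x] in the eigenbasis, with weights [d_i |y_i|^2] and [|y_i|^2]. The
    conclusion is a bound on the form, and not a real orthogonal
    diagonalization, so that the complex eigenvectors never have to be replaced
    by real ones. *)
Lemma symmetric_spectral (R : rcfType) n (S : 'M[R]_n) : S^T = S ->
  exists2 d : 'rV[R]_n,
    char_poly S = \prod_i ('X - (d 0 i)%:P) &
    forall (c : R) (x : 'cV[R]_n),
      (forall i, c <= d 0 i) -> c * quad 1%:M x <= quad S x.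
Proof.
move=> Ssym; pose f := real_complex R.
pose A : 'M[R[i]]_n := map_mx f S.
have freal m p (M : 'M[R]_(m, p)) : map_mx f M \is a realmx.
  by apply/mxOverP => i j; rewrite mxE; apply/complex_realP; exists (M i j).
have Aherm : A \is hermsymmx.
  apply: realsym_hermsym (freal _ _ _).
  by apply/is_hermitianmxP; rewrite expr0 scale1r map_mx_id// /A map_trmx Ssym.
have /orthomx_spectralP := hermitian_normalmx Aherm.
have /mxOverP dreal := hermitian_spectral_diag_real Aherm.
set P := spectralmx A; set sp := spectral_diag A => AE.
have Pu : P \is unitarymx := spectral_unitarymx A.
pose d : 'rV[R]_n := \row_i complex.Re (sp 0 i).
have dE i : f (d 0 i) = sp 0 i by rewrite mxE /f RRe_real.
exists d.
  apply: (@map_poly_inj _ _ f); rewrite map_char_poly rmorph_prod.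
  rewrite -/A (char_poly_similar (unitarymx_unit Pu) AE).
  rewrite char_poly_trig ?diag_mx_is_trig//.
  apply: eq_bigr => i _; rewrite rmorphB /= map_polyX map_polyC /=.
  by rewrite mxE eqxx mulr1n -dE.
move=> c x cd; pose y := P *m map_mx f x.
have xt : (map_mx f x)^T = map_mx f x ^t*.
  by rewrite map_trmx (realmxC (freal _ _ _)).
have yt : map_mx f x ^t* *m P ^t* = y ^t*.
  by rewrite /y trmx_mul map_mxM.
have fquad M : f (quad M x) = ((map_mx f x)^T *m map_mx f M *m map_mx f x) 0 0.
  by rewrite /quad map_trmx -!map_mxM [RHS]mxE.
have fS : f (quad S x) = \sum_i sp 0 i * (y i 0 * (y i 0)^*).
  rewrite fquad -/A AE invmx_unitary// xt !mulmxA yt -mulmxA mxE.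
  apply: eq_bigr => i _; rewrite mul_mx_diag !mxE; ring.
have f1 : f (quad 1%:M x) = \sum_i (y i 0 * (y i 0)^*).
  rewrite fquad map_mx1 mulmx1 xt.
  have -> : map_mx f x ^t* *m map_mx f x = y ^t* *m y.
    rewrite -yt /y mulmxA -(mulmxA _ _ P) -invmx_unitary//.
    by rewrite mulVmx ?unitarymx_unit// mulmx1.
  by rewrite mxE; apply: eq_bigr => i _; rewrite !mxE mulrC.
rewrite -lecR rmorphM /= -!/(f _) fS f1 mulr_sumr; apply: ler_sum => i _.
by rewrite ler_wpM2r ?mul_conjC_ge0// -dE lecR.
Qed.

(** * The least eigenvalue of a symmetric matrix *)

Section Eigenvalues.
Variables (R : realType) (n : nat) (S : 'M[R]_n).
Hypothesis S_sym : S^T = S.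

(** The characteristic polynomial of a symmetric matrix splits over [R], so that
    the choice made in [eigenvalues] is never the default empty sequence. *)
Lemma eigenvalues_sorted_char_poly :
  sorted >=%R (eigenvalues S) /\
  char_poly S = \prod_(x <- eigenvalues S) ('X - x%:P).
Proof.
apply: (@xgetPex _ _ [set s : seq R | sorted >=%R s /\
   char_poly S = \prod_(x <- s) ('X - x%:P)]%classic).
have [d dE _] := symmetric_spectral S_sym.
exists (sort >=%R [seq d 0 i | i <- enum 'I_n]); split.
  by apply: sort_sorted => x y; apply: ge_total.
rewrite dE (perm_big [seq d 0 i | i <- enum 'I_n]) /=; last by rewrite perm_sort.
by rewrite big_map big_enum.
Qed.

Lemma mem_eigenvalues a : (a \in eigenvalues S) = root (char_poly S) a.
Proof. by rewrite eigenvalues_sorted_char_poly.2 root_prod_XsubC. Qed.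

Lemma size_eigenvalues : size (eigenvalues S) = n.
Proof.
have := size_char_poly S; rewrite eigenvalues_sorted_char_poly.2.
by rewrite size_prod_XsubC => -[].
Qed.

Lemma lambda_min_le a : a \in eigenvalues S -> lambda S n <= a.
Proof.
move=> /(nthP 0)[k]; rewrite size_eigenvalues => kn <-.
have ge_tr : transitive (>=%R : rel R) by move=> x y z /[swap]; apply: le_trans.
rewrite /lambda; apply: (sorted_leq_nth ge_tr (@lexx _ R)) => //.
- exact: eigenvalues_sorted_char_poly.1.
- by rewrite inE size_eigenvalues.
- by rewrite inE size_eigenvalues; case: n kn.
- by case: n kn.
Qed.

Lemma lambda_min_quad x : lambda S n * quad 1%:M x <= quad S x.
Proof.
have [d dE] := symmetric_spectral S_sym; apply=> i; apply: lambda_min_le.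
rewrite mem_eigenvalues dE rootE horner_prod (bigD1 i)//=.
by rewrite hornerXsubC subrr mul0r.
Qed.

(** The minimum of the Rayleigh quotient is attained. The root theory of the
    characteristic polynomial gives a left eigenvector, which symmetry turns
    into a right one. *)
Lemma lambda_min_eigenvector : (0 < n)%N ->
  exists2 x : 'cV[R]_n, x != 0 & S *m x = lambda S n *: x.
Proof.
move=> n_gt0.
have : lambda S n \in eigenvalues S.
  by apply: mem_nth; rewrite size_eigenvalues prednK.
rewrite mem_eigenvalues -eigenvalue_root_char => /eigenvalueP[v vE v0].
exists v^T; last by rewrite -[in LHS]S_sym -trmx_mul vE linearZ.
by rewrite -trmx0 (inj_eq trmx_inj).
Qed.

Lemma psdmx_lambda_min_eq0 : lambda S n = 0 -> psdmx S.
Proof.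
by move=> l0; split=> // x; have := lambda_min_quad x; rewrite l0 mul0r.
Qed.

(** A kernel vector bounds the Rayleigh minimum above by [0]; an eigenvector for
    it bounds it below by [0]. *)
Lemma lambda_min_eq0 (x : 'cV[R]_n) : (0 < n)%N ->
  psdmx S -> x != 0 -> S *m x = 0 -> lambda S n = 0.
Proof.
move=> n_gt0 [_ Spsd] x0 Sx; apply/eqP; rewrite eq_le; apply/andP; split.
  have := lambda_min_quad x.
  rewrite {2}/quad -mulmxA Sx mulmx0 mxE pmulr_lle0//; exact: quad1_gt0.
have [v v0 vE] := lambda_min_eigenvector n_gt0.
have := Spsd v; rewrite -mulmxA vE -scalemxAr mxE.
rewrite pmulr_lge0// -[v^T]mulmx1; exact: quad1_gt0.
Qed.

End Eigenvalues.

(** With [D = diag d], the substitution [y = D^1/2 x] turns the pencil [A - mu D]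
    into the ordinary eigenvalue problem for [N = D^-1/2 A D^-1/2]: the least
    eigenvalue of [N] is [mu], and [x0] is [D^-1/2] times its eigenvector. *)
Lemma pencil_min_eigenvector (R : realType) n (A : 'M[R]_n) (d : 'rV[R]_n) :
    (0 < n)%N -> A^T = A -> (forall i, 0 < d 0 i) ->
  exists mu : R, exists x0 : 'cV[R]_n,
    [/\ x0 != 0, A *m x0 = mu *: (diag_mx d *m x0)
      & forall x, mu * quad (diag_mx d) x <= quad A x].
Proof.
move=> n_gt0 Asym d_gt0.
pose F : 'M[R]_n := diag_mx (\row_i Num.sqrt (d 0 i)).
pose E : 'M[R]_n := diag_mx (\row_i (Num.sqrt (d 0 i))^-1).
have s_neq0 i : Num.sqrt (d 0 i) != 0 by rewrite gt_eqF ?sqrtr_gt0.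
have EF : E *m F = 1%:M.
  rewrite mulmx_diag -diag_const_mx; congr diag_mx; apply/rowP => i.
  by rewrite !mxE mulVf.
have FE : F *m E = 1%:M by exact: mulmx1C.
have FF : F *m F = diag_mx d.
  rewrite mulmx_diag; congr diag_mx; apply/rowP => i.
  by rewrite !mxE -expr2 sqr_sqrtr// ltW.
have Et : E^T = E by exact: tr_diag_mx.
have Ft : F^T = F by exact: tr_diag_mx.
pose N := E^T *m A *m E.
have Nsym : N^T = N by rewrite /N !trmx_mul trmxK Asym mulmxA.
have [v v0 vE] := lambda_min_eigenvector Nsym n_gt0.
exists (lambda N n), (E *m v); split.
- apply: contraNneq v0 => Ev0.
  by rewrite -[v]mul1mx -FE -mulmxA Ev0 mulmx0.
- rewrite -FF -mulmxA (mulmxA F E) FE mul1mx scalemxAr -vE /N Et.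
  by rewrite !mulmxA FE mul1mx.
- move=> x; have := lambda_min_quad Nsym (F *m x).
  by rewrite /N quad_congr !mulmxA EF mul1mx -quad_congr mulmx1 Ft FF.
Qed.

(** * Graph matrices *)

Section Graph.
Variables (R : realType) (V : finType) (G : sgraph V).

Local Notation A := (adjacency R G).
Local Notation D := (degree_mx R G).
Local Notation L := (laplacian R G).

Lemma tr_adjacency : A^T = A.
Proof. by apply/matrixP => i j; rewrite !mxE adj_sym. Qed.

Lemma tr_Bmx a : (Bmx G a : 'M[R]_#|V|)^T = Bmx G a.
Proof.
by rewrite linearD !linearZ /= linearB /= tr_adjacency tr_diag_mx.
Qed.

Lemma BmxE a : Bmx G a = (1 - a) *: D + (2 * a - 1) *: A :> 'M[R]_#|V|.
Proof.
rewrite /Bmx /laplacian scalerBr addrCA -scalerBl; congr (_ + _ *: _).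
ring.
Qed.

Lemma degree_adjacency i :
  (degree G (enum_val i))%:R = \sum_j A i j :> R.
Proof.
rewrite /degree cardsE -sum1_card natr_sum big_mkcond /=.
rewrite (reindex (@enum_val V predT)) /=; last first.
  by apply: onW_bij; apply: enum_val_bij.
apply: eq_bigr => j _; rewrite mxE -topredE /=.
by case: (adj G _ _).
Qed.

(** Each edge [uv] contributes the square [(x_u - x_v)^2]. The double sum over
    ordered pairs meets every edge twice, hence the factor [2] in the proof. *)
Lemma quad_laplacian_ge0 x : 0 <= quad L x.
Proof.
suff : 0 <= 2 * quad L x by rewrite pmulr_rge0.
have -> : 2 * quad L x =
    \sum_i \sum_j A i j * (x i 0 - x j 0) ^+ 2.
  have DE : quad D x = \sum_i \sum_j A i j * x i 0 ^+ 2.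
    rewrite quad_diag; apply: eq_bigr => i _.
    by rewrite mxE degree_adjacency mulr_suml.
  have DE' : quad D x = \sum_i \sum_j A i j * x j 0 ^+ 2.
    rewrite DE exchange_big; apply: eq_bigr => i _; apply: eq_bigr => j _ /=.
    by rewrite -[in LHS]tr_adjacency mxE.
  have -> : 2 * quad L x = quad D x + quad D x + (- 2) * quad A x.
    by rewrite /laplacian -scaleN1r quadD quadZ; ring.
  rewrite {1}DE DE' quadE mulr_sumr -!big_split; apply: eq_bigr => i _ /=.
  rewrite mulr_sumr -!big_split; apply: eq_bigr => j _ /=; ring.
apply: sumr_ge0 => i _; apply: sumr_ge0 => j _.
by rewrite mulr_ge0 ?sqr_ge0// mxE ler0n.
Qed.

End Graph.

(** Evaluating a form on [e_i - e_j] isolates the entries at [i] and [j]; for an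
    adjacency matrix and an edge the value is [-2]. *)
Lemma quad_delta_sub (R : comPzRingType) n (S : 'M[R]_n) i j :
  quad S (delta_mx i 0 - delta_mx j 0) = S i i - S i j - S j i + S j j.
Proof.
rewrite /quad [(_ - _)^T]linearB /= !trmx_delta mulmxBl -!rowE mulmxBr -!colE !mxE.
ring.
Qed.

Lemma degree_gt0 (V : finType) (G : sgraph V) v :
  ~~ isolated G v -> (0 < degree G v)%N.
Proof.
move=> /forallPn[w]; rewrite negbK => vw; rewrite /degree card_gt0.
by apply/set0Pn; exists w; rewrite inE.
Qed.

(** * The threshold *)

Lemma is_max_unique (R : realType) (X : set R) m m' :
  is_max X m -> is_max X m' -> m = m'.
Proof.
by move=> [Xm mX] [Xm' m'X]; apply/le_anti; rewrite m'X// mX.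
Qed.

Theorem theorem3p3 (R : realType) (V : finType) (G : sgraph V) (alpha : R)
    (V_gt0 : (0 < #|V|)%N)
    (no_isolated : forall v : V, ~~ isolated G v)
    (alpha01 : 0 <= alpha <= 1) :
  psdmx (Bmx G alpha) <-> 0 <= alpha <= beta_o R G.
Proof.
pose A := adjacency R G; pose D := degree_mx R G.
have d_gt0 i : 0 < (\row_i (degree G (enum_val i))%:R : 'rV[R]_#|V|) 0 i.
  by rewrite mxE ltr0n degree_gt0.
have [mu [x0 [x0_neq0 Ax0 muP]]] :=
  pencil_min_eigenvector V_gt0 (tr_adjacency R G) d_gt0.
rewrite -/(degree_mx R G) -/A -/D in Ax0 muP.
have Dx_gt0 x : x != 0 -> 0 < quad D x by exact: quad_diag_gt0.
(* For an edge ij, the vector e_i - e_j has a negative value of A. *)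
have mu_lt0 : mu < 0.
  have /forallPn[w] := no_isolated (enum_val (Ordinal V_gt0)).
  rewrite negbK => vw; pose i := Ordinal V_gt0; pose j := enum_rank w.
  have Aij : A i j = 1 by rewrite mxE enum_rankK vw.
  have Aji : A j i = 1 by rewrite mxE enum_rankK adj_sym vw.
  have A0 k : A k k = 0 by rewrite mxE adj_irrefl.
  have := muP (delta_mx i 0 - delta_mx j 0).
  rewrite [quad A _]quad_delta_sub Aij Aji !A0.
  set x := _ - _; have [->|/Dx_gt0] := eqVneq x 0.
    by rewrite /quad mulmx0 mxE; lra.
  by nra.
(* The zero in a of (1 - a) + (2 a - 1) mu, the factor of D x0 in B_a x0. *)
pose b := (1 - mu) / (1 - 2 * mu).
have bE : b * (1 - 2 * mu) = 1 - mu by rewrite divfK//; lra.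
have b01 : 0 < b < 1 by apply/andP; split; nra.
have quadB a x : quad (Bmx G a) x = (1 - a) * quad D x + (2 * a - 1) * quad A x.
  by rewrite BmxE quadD !quadZ.
have Bx0 a : Bmx G a *m x0 = (1 - mu - a * (1 - 2 * mu)) *: (D *m x0).
  rewrite BmxE mulmxDl -!scalemxAl Ax0 scalerA -scalerDl; congr (_ *: _).
  ring.
have psdB a : 0 <= a <= 1 -> psdmx (Bmx G a) <-> a <= b.
  move=> /andP[a0 a1]; split.
    move=> [_ /(_ x0)]; rewrite -mulmxA Bx0 -scalemxAr mxE mulmxA.
    rewrite pmulr_lge0; last exact: Dx_gt0.
    by rewrite subr_ge0 -bE ler_pM2r//; lra.
  move=> ab; split=> [|x]; first exact: tr_Bmx.
  have L0 := quad_laplacian_ge0 G x.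
  have LE : quad (laplacian R G) x = quad D x - quad A x.
    by rewrite /laplacian -scaleN1r quadD quadZ mulN1r.
  have Bb0 : 0 <= quad (Bmx G b) x.
    rewrite quadB; have := muP x; nra.
  (* B_a is the convex combination of B_0 = L and B_b with weights 1 - a / b
     and a / b; the denominator is cleared. *)
  have BaE : b * quad (Bmx G a) x =
      (b - a) * quad (laplacian R G) x + a * quad (Bmx G b) x.
    rewrite !quadB LE; ring.
  have [b0 _] := andP b01; change (0 <= quad (Bmx G a) x).
  by rewrite -(pmulr_rge0 _ b0) BaE addr_ge0// mulr_ge0// subr_ge0.
have beta_max : is_max
    [set c : R | 0 < c < 1 /\ lambda (Bmx G c) #|V| = 0]%classic b.
  split.
    split=> //; apply: (lambda_min_eq0 (tr_Bmx _ _) V_gt0 _ x0_neq0).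
      by apply/psdB => //; lra.
    by rewrite Bx0 bE subrr scale0r.
  move=> c [/andP[c0 c1]] /(psdmx_lambda_min_eq0 (tr_Bmx _ _)).
  by move/psdB; apply; lra.
have -> : beta_o R G = b.
  rewrite /beta_o; case: xgetP => [c _ /is_max_unique|/(_ b)//].
  by apply.
by have [a0 _] := andP alpha01; rewrite a0; exact: psdB.
Qed.
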